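(* Let $n\geq 1$. If every $\mathbf{\Sigma}^1_{2n}$ subset of $\omega^\omega$ is determined, then every $\mathbf{\Sigma}^1_{2n+1}$ subset of $\omega^\omega$ has the Baire property.
   Context: $\omega^\omega$ is the Baire space. The boldface projective classes on Polish spaces are: $\mathbf{\Sigma}^1_1$ is the class of analytic sets (projections to $X$ of closed subsets of $X\times\omega^\omega$); $\mathbf{\Pi}^1_n$ is the class of complements of $\mathbf{\Sigma}^1_n$ sets; $\mathbf{\Sigma}^1_{n+1}$ is the class of projections to $X$ of $\mathbf{\Pi}^1_n$ subsets of $X\times\omega^\omega$. A set $A\subset\omega^\omega$ is determined if one of the two players has a winning strategy in the game $G(A)$, in which Players I and II alternately play natural numbers $k_0,k_1,k_2,\ldots$ (I starts, perfect information), and I wins iff $(k_0,k_1,k_2,\ldots)\in A$, otherwise II wins. A set $A$ has the Baire property if there is an open set $U$ such that the symmetric difference $A\triangle U$ is meager. *)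

(* Defs.v *)
From HB Require Import structures.
From mathcomp Require Import all_boot.
From mathcomp Require Import all_classical topology.

Set Implicit Arguments.
Unset Strict Implicit.
Unset Printing Implicit Defensive.

Local Open Scope classical_set_scope.

(* [nat] carries the discrete topology, so this is the product topology. *)
Definition baire_space : Type := prod_topology (fun _ : nat => nat).

HB.instance Definition _ := Topological.on baire_space.

Definition analytic (X : topologicalType) (A : set X) : Prop :=
  exists2 C : set (X * baire_space), closed C & A = fst @` C.

(* Boldface projective classes. The clauses make sense over any topological
   space; starting from a Polish X they only involve the Polish spaces X,
   X * baire_space, (X * baire_space) * baire_space, etc. The classes are
   indexed from 1; at index 0 no set is Sigma^1_0. *)
Fixpoint Sigma1 (n : nat) (X : topologicalType) (A : set X) : Prop :=
  match n with
  | 0 => False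
  | 1 => analytic A
  | m.+1 => exists2 B : set (X * baire_space), Sigma1 m (~` B) & A = fst @` B
  end.

Definition Pi1 (n : nat) (X : topologicalType) (A : set X) : Prop :=
  Sigma1 n (~` A).

Lemma Sigma1S (n : nat) (X : topologicalType) (A : set X) : 0 < n ->
  Sigma1 n.+1 A =
  (exists2 B : set (X * baire_space), Pi1 n B & A = fst @` B).
Proof. by case: n. Qed.

(* The position reached after m moves of the run x. *)
Definition position (x : baire_space) (m : nat) : seq nat := mkseq x m.

(* A strategy gives the next move at each position; only its values at
   positions where its owner is to move (even length for I, odd length for II)
   matter. *)
Definition strategy : Type := seq nat -> nat.

Definition follows_I (s : strategy) (x : baire_space) : Prop :=
  forall m, ~~ odd m -> x m = s (position x m).

Definition follows_II (s : strategy) (x : baire_space) : Prop :=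
  forall m, odd m -> x m = s (position x m).

Definition winning_I (A : set baire_space) (s : strategy) : Prop :=
  forall x, follows_I s x -> A x.

Definition winning_II (A : set baire_space) (s : strategy) : Prop :=
  forall x, follows_II s x -> ~ A x.

Definition determined (A : set baire_space) : Prop :=
  (exists s, winning_I A s) \/ (exists s, winning_II A s).

Definition nowhere_dense (X : topologicalType) (A : set X) : Prop :=
  interior (closure A) = set0.

Definition meager (X : topologicalType) (A : set X) : Prop :=
  exists2 N : nat -> set X, forall k, nowhere_dense (N k) & A = \bigcup_k N k.

Definition Baire_property (X : topologicalType) (A : set X) : Prop :=
  exists2 U : set X, open U & meager (A `+` U).

(* Main.v *)
Require Import Defs.
From mathcomp Require Import all_boot.
From mathcomp Require Import all_classical topology.

Set Implicit Arguments.
Unset Strict Implicit.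
Unset Printing Implicit Defensive.

(** The proof is the unfolded Banach-Mazur game, and it gives more generally
that determinacy of all Sigma^1_k sets (k >= 1) implies the Baire property of
all Sigma^1_(k+1) sets [Baire_property_Sigma1S].

Let A be the projection of a Pi^1_k set B and let s be a finite sequence. The
players alternately play nonempty finite blocks, whose concatenation after s
is a point x; with each block, player I also plays one digit of a point y.
Player I wins iff (x, y) is in B. Since (x, y) depends continuously on the
run, the payoff set is Pi^1_k, and it is determined: adding a dummy first move
exchanges the players and turns its complement, which is Sigma^1_k, into a
payoff set [determined_dual].

Fix a strategy r of either player. At a position q where the opponent is to
move, call x a gap of r if x extends what has been built so far but no block
played with a prescribed digit d leads, after the answer of r, to a longer
initial segment of x. The opponent may play any block, so the set of gaps for
given d and q is nowhere dense, and there are only countably many such sets.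
A point x that is not a gap can be steered to: some run against r produces x
together with any prescribed sequence of the opponent's digits
[run_avoiding_gaps]. If r wins for I, every non-gap x extending the first move
of r is thus in A, so A is comeager in a cylinder inside that of s
[winning_I_comeager]. If r wins for II, a non-gap x in A could be steered to
with a witness y of its membership, contradicting that r wins; so A is meager
in the cylinder of s [winning_II_meager]. A set with this dichotomy at every s
has the Baire property [Baire_property_localize]. *)

Local Open Scope classical_set_scope.

(** * Cylinders and the topology of the Baire space *)

Definition cylinder (p : seq nat) : set baire_space :=
  [set x | forall i, i < size p -> x i = nth 0 p i].

Lemma cylinder_position (x : baire_space) m : cylinder (position x m) x.
Proof. by move=> i; rewrite size_mkseq => im; rewrite nth_mkseq. Qed.

Lemma cylinder_catl p w : cylinder (p ++ w) `<=` cylinder p.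
Proof.
by move=> x xpw i ip; rewrite xpw ?nth_cat ?ip// size_cat ltn_addr.
Qed.

Lemma cylinder_extend p x m : cylinder p x -> size p <= m ->
  p ++ drop (size p) (position x m) = position x m.
Proof.
move=> xp pm; rewrite -[RHS](cat_take_drop (size p)); congr (_ ++ _).
apply: (@eq_from_nth _ 0); first by rewrite size_takel// size_mkseq.
by move=> i ip; rewrite nth_take// nth_mkseq ?xp// (leq_trans ip).
Qed.

Lemma cylinder_nonempty p : cylinder p (nth 0 p).
Proof. by []. Qed.

Lemma cylinder_agree (x y : baire_space) m : cylinder (position x m) y ->
  forall i, i < m -> y i = x i.
Proof. by move=> yx i im; rewrite yx ?size_mkseq// nth_mkseq. Qed.

(** The product topology is the supremum of the topologies induced by the
coordinates; the cylinders turn it into a concrete neighbourhood basis. *)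
Lemma nbhs_baireP (x : baire_space) (A : set baire_space) :
  nbhs x A <-> exists m, cylinder (position x m) `<=` A.
Proof.
split.
  (* The cylinders around x generate a filter converging to x at every
     coordinate, hence in the product. *)
  pose F : set_system baire_space :=
    [set B | exists m, cylinder (position x m) `<=` B].
  have FF : Filter F.
    split; first by exists 0.
    - move=> B C [m mB] [l lC]; exists (m + l) => y yx; split.
        apply: mB => i; rewrite size_mkseq => im.
        by rewrite (cylinder_agree yx) ?nth_mkseq// ltn_addr.
      apply: lC => i; rewrite size_mkseq => il.
      by rewrite (cylinder_agree yx) ?nth_mkseq// ltn_addl.
    - by move=> B C BC [m mB]; exists m; exact: subset_trans BC.
  suff : F --> x by apply.
  apply/cvg_sup => i B [_ [[C oC <-] /= Cx CB]].
  exists i.+1 => y /cylinder_agree yx; apply: CB => /=.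
  by rewrite yx.
move=> [m mA]; apply: filterS mA _.
elim: m => [|m IHm]; first by apply: filterS filterT => y _ i.
have nm : nbhs x (@proj nat (fun=> nat) m @^-1` [set x m]).
  by apply: (@proj_continuous nat (fun=> nat) m x); rewrite nbhs_principalE.
apply: filterS (filterI IHm nm) => y [/cylinder_agree yx ym] i.
rewrite size_mkseq => im; rewrite nth_mkseq//.
by move: im; rewrite ltnS leq_eqVlt => /predU1P[->|/yx].
Qed.

Lemma open_cylinder p : open (cylinder p).
Proof.
rewrite openE => x xp; apply/nbhs_baireP; exists (size p) => y yx i ip.
by rewrite (cylinder_agree yx)// xp.
Qed.

Lemma continuous_baire (h : baire_space -> baire_space) :
  (forall i, exists m, forall k k', position k m = position k' m ->
    h k i = h k' i) -> continuous h.
Proof.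
move=> hh k A /nbhs_baireP[l lA].
have [m hm] : exists m, forall k', cylinder (position k m) k' ->
    forall i, i < l -> h k' i = h k i.
  elim: {lA} l => [|l [m IH]]; first by exists 0.
  (* A common modulus for the coordinates below l and for coordinate l. *)
  have [j hj] := hh l.
  exists (m + j) => k' kk' i; rewrite ltnS leq_eqVlt => /predU1P[->|il].
    apply: hj; apply/eq_in_map => n; rewrite mem_iota add0n => /andP[_ nj].
    by rewrite (cylinder_agree kk')// ltn_addl.
  apply: IH => // n; rewrite size_mkseq => nm.
  by rewrite (cylinder_agree kk') ?nth_mkseq// ltn_addr.
apply/nbhs_baireP; exists m => k' /hm hk'; apply: lA => i.
by rewrite size_mkseq => il; rewrite hk'// nth_mkseq.
Qed.

(** * Category *)

(** The usual reformulation in terms of the basis: every cylinder contains a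
cylinder disjoint from A. *)
Lemma nowhere_dense_cylinder (A : set baire_space) :
  (forall p, exists w, cylinder (p ++ w) `&` A `<=` set0) -> nowhere_dense A.
Proof.
move=> hA; apply/seteqP; split=> // x /nbhs_baireP[m mA].
have [w wA] := hA (position x m).
have zw := @cylinder_nonempty (position x m ++ w).
have [z [Az zpw]] := mA _ (cylinder_catl zw) _
  (open_nbhs_nbhs (conj (open_cylinder _) zw)).
by case: (wA z).
Qed.

Lemma nowhere_denseS (X : topologicalType) (A B : set X) :
  A `<=` B -> nowhere_dense B -> nowhere_dense A.
Proof.
move=> AB B0; apply/seteqP; split=> // x; rewrite -B0.
exact/interiorS/closureS.
Qed.

(** Meagerness asks for an exact countable union indexed by the naturals; this
allows a cover indexed by any countable type. *)
Lemma meager_cover (X : topologicalType) (I : countType) (N : I -> set X)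
    (A : set X) :
  (forall i, nowhere_dense (N i)) -> A `<=` \bigcup_i N i -> meager A.
Proof.
move=> ndN AN.
exists (fun k => if unpickle k is Some i then N i `&` A else set0).
  move=> k; case: unpickle => [i|]; first exact: nowhere_denseS (ndN i).
  by rewrite /nowhere_dense closure0 interior0.
apply/seteqP; split=> [x Ax|x [k _]]; last by case: unpickle => // i [].
by have [i _ Nx] := AN x Ax; exists (pickle i) => //; rewrite pickleK.
Qed.

Lemma meager_bigcup (X : topologicalType) (I : countType) (M : I -> set X)
    (A : set X) :
  (forall i, meager (M i)) -> A `<=` \bigcup_i M i -> meager A.
Proof.
move=> mM AM.
have /choice[N hN] : forall i, exists N : nat -> set X,
    (forall k, nowhere_dense (N k)) /\ M i = \bigcup_k N k.
  by move=> i; have [N] := mM i; exists N.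
apply: (@meager_cover _ (I * nat)%type (fun ik => N ik.1 ik.2)) => [[i k]|x Ax].
  exact: (hN i).1.
have [i _] := AM x Ax; rewrite (hN i).2 => -[k _ Nx].
by exists (i, k).
Qed.

(** Take for U the union of the cylinders in which A is comeager; then U minus
A is a countable union of meager sets. A point of A outside U either lies in a
cylinder none of whose subcylinders is one of those, and there A is meager, or
lies on the boundary of U, which is nowhere dense. *)
Lemma Baire_property_localize (A : set baire_space) :
  (forall s, (exists w, meager (cylinder (s ++ w) `\` A)) \/
             meager (cylinder s `&` A)) ->
  Baire_property A.
Proof.
move=> hA; pose co s := meager (cylinder s `\` A).
pose U := \bigcup_(s in co) cylinder s.
exists U; first by apply: bigcup_open => s _; exact: open_cylinder.
(* F is the boundary of U. *)
pose F := [set x | ~ U x /\ forall m, exists w, co (position x m ++ w)].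
have ndF : nowhere_dense F.
  apply: nowhere_dense_cylinder => p.
  have [[w cow]|nco] := pselect (exists w, co (p ++ w)).
    by exists w => x [xpw [+ _]]; apply; exists (p ++ w).
  exists [::] => x []; rewrite cats0 => xp [_ /(_ (size p))].
  by rewrite -(cylinder_extend xp (leqnn _)) drop_oversize ?size_mkseq ?cats0.
pose M (s : option (seq nat + seq nat)) := match s with
  | None => F
  | Some (inl s) => if `[< co s >] then cylinder s `\` A else set0
  | Some (inr s) =>
    if `[< meager (cylinder s `&` A) >] then cylinder s `&` A else set0
  end.
have meager_nd (B : set baire_space) : nowhere_dense B -> meager B.
  by move=> ndB; apply: (@meager_cover _ unit (fun=> B)) => // x; exists tt.
have meager0 : meager (set0 : set baire_space).
  by apply: meager_nd; rewrite /nowhere_dense closure0 interior0.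
apply: (@meager_bigcup _ _ M) => [[[]s|]|x]; rewrite /M.
- by case: asboolP.
- by case: asboolP.
- exact: meager_nd.
case=> -[]; last first.
  move=> [s cos xs] nAx; exists (Some (inl s)) => //.
  by rewrite asboolT.
move=> Ax nUx; have [Fx|nFx] := pselect (F x); first by exists None.
have [m hm] : exists m, ~ exists w, co (position x m ++ w).
  by apply: contrapT => /forallNP h; apply: nFx; split=> // m; apply: contrapT.
exists (Some (inr (position x m))) => //.
have [//|mA] := hA (position x m).
by rewrite asboolT//; split=> //; exact: cylinder_position.
Qed.

(** * Projective classes and determinacy *)

(** The pullback of a projection is the projection of the pullback along
h x id; the case of closed sets is continuity. *)
Lemma Sigma1_preimage n (X Y : topologicalType) (h : X -> Y) (A : set Y) :
  continuous h -> Sigma1 n A -> Sigma1 n (h @^-1` A).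
Proof.
have lift (X' Y' : topologicalType) (f : X' -> Y') : continuous f ->
    continuous (fun z : X' * baire_space => (f z.1, z.2)).
  move=> cf z.
  apply: (@cvg_pair _ _ _ (nbhs z) (nbhs (f z.1)) (nbhs z.2));
    last exact: cvg_snd.
  exact: (cvg_comp fst f cvg_fst (cf z.1)).
have preim (X' Y' : topologicalType) (f : X' -> Y')
    (C : set (Y' * baire_space)) :
    f @^-1` (fst @` C) =
    fst @` ((fun z : X' * baire_space => (f z.1, z.2)) @^-1` C).
  apply/seteqP; split=> [x [[y z] Cyz /= fx]|_ [[x z] Cxz <-]].
    by exists (x, z) => //=; rewrite -fx.
  by exists (f x, z).
elim: n X Y h A => [//|[|n] IH] X Y h A ch [C SC ->]; rewrite preim.
  eexists; last by [].
  exact: (continuous_closedP _).1 (lift _ _ _ ch) _ SC.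
eexists; last by [].
exact: IH (lift _ _ _ ch) SC.
Qed.

Definition run_cons (a : nat) (x : baire_space) : baire_space :=
  fun i => if i is j.+1 then x j else a.

Lemma position_cons a x m : position (run_cons a x) m.+1 = a :: position x m.
Proof. by rewrite /position /mkseq /= (iotaDl 1 0) -map_comp. Qed.

(** If the first move of I is ignored, II becomes the first to make a move that
counts. So in the game for the shifted complement of P, player I plays as II
does in the game for P, and conversely. *)
Lemma determined_dual k (P : set baire_space) :
  (forall A : set baire_space, Sigma1 k A -> determined A) ->
  Pi1 k P -> determined P.
Proof.
move=> hdet SP; pose shift (x : baire_space) : baire_space := fun i => x i.+1.
have cshift : continuous shift.
  apply: continuous_baire => i; exists i.+2 => x y xy.
  have /(congr1 (nth 0 ^~ i.+1)) := xy.
  by rewrite !nth_mkseq.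
have [[s ws]|[s ws]] := hdet _ (Sigma1_preimage cshift SP).
  right; exists (fun q => s (s [::] :: q)) => x xs.
  apply: (ws (run_cons (s [::]) x)) => -[//|m] /=; rewrite negbK => om.
  by rewrite position_cons xs.
left; exists (fun q => s (0 :: q)) => x xs.
apply: contrapT; apply: (ws (run_cons 0 x)) => -[//|m] /= om.
by rewrite position_cons xs.
Qed.

(** * The unfolded Banach-Mazur game *)

(** A move is decoded as a digit together with a nonempty block (first entry
and rest). Every natural number decodes to something, so the game has no rules
to enforce. *)
Definition move (m : nat) : nat * (nat * seq nat) :=
  odflt (0, (0, [::])) (unpickle m).
Definition digit m := (move m).1.
Definition block m := (move m).2.1 :: (move m).2.2.

Lemma moveP d w : w <> [::] -> exists m, digit m = d /\ block m = w.
Proof.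
case: w => // a w _; exists (pickle (d, (a, w))).
by rewrite /digit /block /move pickleK.
Qed.

Definition stem (s q : seq nat) := s ++ flatten [seq block m | m <- q].

Definition outcome (s : seq nat) (k : baire_space) : baire_space :=
  fun i => nth 0 (stem s (position k i.+1)) i.

Definition witness (k : baire_space) : baire_space := fun i => digit (k i.*2).

Lemma stem_rcons s q m : stem s (rcons q m) = stem s q ++ block m.
Proof. by rewrite /stem map_rcons flatten_rcons catA. Qed.

Lemma size_stem s q : size q <= size (stem s q).
Proof.
elim/last_ind: q => // q m IH; rewrite stem_rcons size_rcons size_cat /= addnS.
by rewrite ltnS (leq_trans IH)// leq_addr.
Qed.

Lemma outcome_unique s k x :
  (forall m, cylinder (stem s (position k m)) x) -> outcome s k = x.
Proof.
move=> xk; apply/funext => i; rewrite [RHS](xk i.+1)//.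
by apply: leq_trans (size_stem _ _); rewrite size_mkseq.
Qed.

Lemma continuous_outcome_witness s :
  continuous (fun k => (outcome s k, witness k)).
Proof.
move=> k.
apply: (@cvg_pair _ _ _ (nbhs k) (nbhs (outcome s k)) (nbhs (witness k)));
  apply: continuous_baire => i.
  by exists i.+1 => x y xy; rewrite /outcome xy.
exists i.*2.+1 => x y /(congr1 (nth 0 ^~ i.*2)).
by rewrite /witness !nth_mkseq// => ->.
Qed.

(** The points that are still possible at the position q, but that the
opponent cannot keep possible by any move with digit d once r has answered. *)
Definition gap (s : seq nat) (r : strategy) (d : nat) (q : seq nat) :
    set baire_space :=
  [set x | cylinder (stem s q) x /\
    forall m, digit m = d ->
      ~ cylinder (stem s (rcons (rcons q m) (r (rcons q m)))) x].

(** Given a word p compatible with the stem at q, take a proper extension of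
both and let the opponent play the block that reaches it: every point beyond
the answer of r fails to be a gap. *)
Lemma nowhere_dense_gap s r d q : nowhere_dense (gap s r d q).
Proof.
apply: nowhere_dense_cylinder => p.
have [[x [xp xq]]|npq] :=
    pselect (exists x, cylinder p x /\ cylinder (stem s q) x); last first.
  by exists [::] => x; rewrite cats0 => -[xp [xq _]]; apply: npq; exists x.
(* The successor makes the block to be played nonempty. *)
pose l := (maxn (size p) (size (stem s q))).+1.
have pl := cylinder_extend (m := l) xp (leqW (leq_maxl _ _)).
have ql := cylinder_extend (m := l) xq (leqW (leq_maxr _ _)).
have [|m [dm bm]] := @moveP d (drop (size (stem s q)) (position x l)).
  move/(congr1 size)/eqP.
  by rewrite size_drop size_mkseq subn_eq0 leqNgt ltnS leq_maxr.
exists (drop (size p) (position x l) ++ block (r (rcons q m))).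
move=> z [zp [_ /(_ m dm)]]; apply.
by rewrite !stem_rcons bm ql -pl -catA.
Qed.

Lemma run_of_strategy (f : strategy) :
  exists k : baire_space, forall m, k m = f (position k m).
Proof.
pose pos := fix pos m := if m is j.+1 then rcons (pos j) (f (pos j)) else [::].
exists (fun m => f (pos m)) => m; congr f.
by elim: m => // m IH; rewrite /position mkseqS -[mkseq _ _]/(position _ m) -IH.
Qed.

(** Here r is the strategy of II if b holds and of I otherwise; b is the parity
of the lengths of the positions at which r moves. Whenever the opponent is to
move, the stem is an initial segment of x, and as x is not a gap some move
with the prescribed digit keeps it so after the answer of r. *)
Lemma run_avoiding_gaps (b : bool) s (r : strategy) (x y : baire_space) :
  cylinder (stem s (if b then [::] else [:: r [::]])) x ->
  (forall d q, ~ gap s r d q x) ->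
  exists k : baire_space, [/\ forall m, odd m = b -> k m = r (position k m),
    outcome s k = x & forall m, odd m = ~~ b -> digit (k m) = y m./2].
Proof.
move=> x0 xgap.
(* c is the opponent's strategy steering to x. *)
have /choice[c hc] : forall q, exists m, cylinder (stem s q) x ->
    digit m = y (size q)./2 /\
    cylinder (stem s (rcons (rcons q m) (r (rcons q m)))) x.
  move=> q; have [xq|] := pselect (cylinder (stem s q) x); last by exists 0.
  have := xgap (y (size q)./2) q.
  move/not_andP => [//|/existsNP[m /not_implyP[dm /contrapT xm]]].
  by exists m.
have [k hk] := run_of_strategy
  (fun q => if odd (size q) == b then r q else c q).
have kr m : odd m = b -> k m = r (position k m).
  by move=> mb; rewrite hk size_mkseq mb eqxx.
have kc m : odd m = ~~ b -> k m = c (position k m).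
  by move=> mb; rewrite hk size_mkseq mb; case: (b).
have kx m : odd m = ~~ b -> cylinder (stem s (position k m)) x.
  elim/ltn_ind: m => -[|[|m]] IH /= mb.
  - by move: mb x0; case: (b).
  - move: mb x0 kr; case: (b) => // _ x0 /(_ 0 erefl).
    by rewrite /position /mkseq /= => ->.
  rewrite negbK in mb.
  have [_] := hc _ (IH m (leqnSn _) mb).
  rewrite /position !mkseqS -!/(position _ _) -kc//.
  suff -> : k m.+1 = r (rcons (position k m) (k m)) by [].
  by rewrite kr /= ?mb ?negbK// /position mkseqS.
exists k; split=> // [|m mb].
  apply: outcome_unique => m.
  have [mb|mb] := eqVneq (odd m) (~~ b); first exact: kx.
  apply: (@cylinder_catl _ (block (k m))).
  rewrite -stem_rcons -mkseqS; apply: kx => /=.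
  by move: mb; case: (odd m); case: (b).
by rewrite kc//; have [+ _] := hc _ (kx m mb); rewrite size_mkseq.
Qed.

Definition payoff (B : set (baire_space * baire_space)) (s : seq nat) :
    set baire_space := [set k | B (outcome s k, witness k)].

Lemma winning_I_comeager B s r : winning_I (payoff B s) r ->
  meager (cylinder (stem s [:: r [::]]) `\` fst @` B).
Proof.
move=> wr.
apply: (@meager_cover _ (nat * seq nat)%type
  (fun i => gap s r i.1 i.2)) => [i|].
  exact: nowhere_dense_gap.
move=> x [xs nBx]; apply: contrapT => ngap.
(* An arbitrary choice of digits for II. *)
have [|k [kr kx _]] := @run_avoiding_gaps false s r x (fun=> 0) xs.
  by move=> d q xdq; apply: ngap; exists (d, q).
apply: nBx; exists (outcome s k, witness k) => //.
by apply: wr => m /negbTE; exact: kr.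
Qed.

Lemma winning_II_meager B s r : winning_II (payoff B s) r ->
  meager (cylinder s `&` fst @` B).
Proof.
move=> wr.
apply: (@meager_cover _ (nat * seq nat)%type
  (fun i => gap s r i.1 i.2)) => [i|].
  exact: nowhere_dense_gap.
move=> x' [xs' [[x y] Bxy /= def_x]]; move: xs'; rewrite -{x'}def_x => xs.
apply: contrapT => ngap.
have [||k [kr kx ky]] := @run_avoiding_gaps true s r x y.
- by rewrite /stem cats0.
- by move=> d q xdq; apply: ngap; exists (d, q).
apply: (wr k) => [m om|]; first exact: kr.
suff -> : payoff B s k = B (x, y) by [].
rewrite /payoff /= kx; congr (B (_, _)); apply/funext => i.
by rewrite /witness ky ?odd_double// doubleK.
Qed.

Lemma Baire_property_Sigma1S k (A : set baire_space) : 0 < k ->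
  (forall P : set baire_space, Sigma1 k P -> determined P) ->
  Sigma1 k.+1 A -> Baire_property A.
Proof.
move=> k0 hdet; rewrite Sigma1S// => -[B PiB ->].
apply: Baire_property_localize => s.
have Pi_payoff : Pi1 k (payoff B s).
  exact: (Sigma1_preimage (@continuous_outcome_witness s) PiB).
have [[r wr]|[r wr]] := determined_dual hdet Pi_payoff.
  left; exists (block (r [::])).
  have := winning_I_comeager wr.
  by rewrite /stem /= cats0.
by right; exact: winning_II_meager wr.
Qed.

Local Close Scope classical_set_scope.

Theorem mainTheorem3 (n : nat) (hn : 1 <= n)
    (hdet : forall A : set baire_space, Sigma1 (2 * n) A -> determined A) :
  forall A : set baire_space, Sigma1 (2 * n + 1) A -> Baire_property A.
Proof.
move=> A; rewrite addn1; apply: Baire_property_Sigma1S => //.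
by rewrite muln_gt0.
Qed.
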